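(* Let $\Phi_1,\dots,\Phi_N$ be independent stationary simple locally finite point processes on $\mathbb{R}$ with finite intensities $\lambda_i>0$, with natural histories $\mathcal{F}^{(i)}_t$ and stochastic intensities $\lambda_i(t)$ with respect to $\mathcal{F}^{(i)}_t$. Let $\mathcal{F}_t=\sigma(\mathcal{F}_t^{(i)};\,i=1,\dots,N)$, $\Phi=\sum_{i=1}^N\Phi_i$, and let $C<N$ be the memory capacity. For a causal policy $\mathcal{C}$ let $\Psi_{\mathcal{C}}$ be its hit process, $h_{\mathcal{C}}$ its hit rate (mean intensity of $\Psi_{\mathcal{C}}$), $H_{\mathcal{C}}:=P^0_\Phi(\Psi_{\mathcal{C}}(\{0\})=1)$ its hit probability, and $\lambda_{\mathcal{C}}(t)=\sum_{i=1}^N\lambda_i(t)\mathbf{1}_{\{i\in\mathcal{C}(t)\}}$. Let $\mathcal{C}^*$ be the policy that at every time $t$ stores the $C$ items with the highest stochastic intensities $\lambda_i(t)$, i.e. $\mathcal{C}^*(t)\in\arg\max_{\mathcal{C}\in\mathscr{P}_C(N)}\sum_{i\in\mathcal{C}}\lambda_i(t)$. Then for any causal policy $\mathcal{C}$, $$h_{\mathcal{C}}=\mathrm{E}[\lambda_{\mathcal{C}}(0)]\le \mathrm{E}[\lambda_{\mathcal{C}^*}(0)]=h_{\mathcal{C}^*}.$$ In addition, the hit probability is also maximized by $\mathcal{C}^*$: $H_{\mathcal{C}}\le H_{\mathcal{C}^*}$ for every causal policy $\mathcal{C}$.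
   Context: Framework: $(\Omega,\mathcal{F},P)$ is a probability space with a measurable flow $\{\vartheta_t\}_{t\in\mathbb{R}}$ preserving $P$; stationary point processes satisfy $\Phi(\vartheta_t\omega)(B)=\Phi(\omega)(B+t)$ and stationary stochastic processes satisfy $X(t,\omega)=X(0,\vartheta_t\omega)$. The intensity of a stationary point process $\Phi$ is $\lambda=\mathrm{E}[\Phi((0,1])]$, and its Palm probability is $P^0_\Phi(A)=\frac1\lambda\mathrm{E}\left[\int_{(0,1]}\mathbf{1}_A(\vartheta_s\omega)\,\Phi(ds)\right]$. History: a filtration $\{\mathcal{F}_t\}_{t\in\mathbb{R}}$ is a history of $\Phi$ if $\Phi((a,b])$ is $\mathcal{F}_t$-measurable for all $a<b\le t$; the natural history is the smallest such filtration. Stochastic intensity: a locally integrable, $\mathcal{F}_t$-adapted process $\lambda(t)\ge0$ is an $\mathcal{F}_t$-stochastic intensity of $\Phi$ if $\mathrm{E}[\Phi((s,t])\mid\mathcal{F}_s]=\mathrm{E}[\int_s^t\lambda(u)\,du\mid\mathcal{F}_s]$ for all $s<t$. The stochastic intensities $\lambda_i(t)$ are assumed to exist and are taken in their predictable, stationary versions. Predictability: the predictable $\sigma$-algebra of $\{\mathcal{F}_t\}$ on $\mathbb{R}\times\Omega$ is generated by the sets $(a,b]\times A$ with $a<b$, $A\in\mathcal{F}_a$; a process $X(t,\omega)$ is $\mathcal{F}_t$-predictable if it is measurable with respect to it. Local memory system: $\mathscr{P}_C(N)$ is the set of subsets of $\{1,\dots,N\}$ of size at most $C$, with the discrete $\sigma$-algebra.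 A causal (memory management) policy is a stationary $\mathcal{F}_t$-predictable process $\mathcal{C}(t)$ with values in $\mathscr{P}_C(N)$. Its hit process is $\Psi_{\mathcal{C}}(B)=\sum_{i=1}^N\int_B\mathbf{1}_{\{i\in\mathcal{C}(t)\}}\Phi_i(dt)$, and its hit rate is $h_{\mathcal{C}}=\mathrm{E}[\Psi_{\mathcal{C}}((0,1])]$. In the definition of $\mathcal{C}^*$ ties are broken by an arbitrary fixed deterministic rule (e.g. smallest index first), so that $\mathcal{C}^*$ is itself a causal policy. *)

(* Defs.v *)
From HB Require Import structures.
From mathcomp Require Import all_boot all_order all_algebra.
From mathcomp Require Import all_classical all_reals all_analysis.
From mathcomp Require Import measurable_realfun.

Set Implicit Arguments.
Unset Strict Implicit.
Unset Printing Implicit Defensive.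
Import Order.TTheory GRing.Theory Num.Theory.
Import numFieldNormedType.Exports.

Local Open Scope classical_set_scope.
Local Open Scope ring_scope.
Local Open Scope ereal_scope.

Definition measurable_flow {d} {Omega : measurableType d} {R : realType}
    (P : probability Omega R) (theta : R -> Omega -> Omega) : Prop :=
  [/\ measurable_fun [set: R * Omega] (fun x => theta x.1 x.2),
      forall w, theta 0%R w = w,
      forall s t w, theta (s + t)%R w = theta s (theta t w) &
      forall t A, measurable A -> P (theta t @^-1` A) = P A].

Definition stationary_process {Omega T : Type} {R : realType}
    (theta : R -> Omega -> Omega) (X : R -> Omega -> T) : Prop :=
  forall t w, X t w = X 0%R (theta t w).

(** Point processes on the line are kernels from the sample space to [R]:
    [Phi w B] is the number of points of the configuration [w] in [B], and the
    kernel axiom says that [Phi ^~ B] is a random variable for Borel [B]. *)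

Definition point_process {d} {Omega : measurableType d} {R : realType}
    (Phi : R.-ker Omega ~> measurableTypeR R) : Prop :=
  forall w (B : set R), measurable B -> bounded_set B ->
    exists n : nat, Phi w B = n%:R%:E.

Definition simple_process {d} {Omega : measurableType d} {R : realType}
    (P : probability Omega R) (Phi : R.-ker Omega ~> measurableTypeR R) : Prop :=
  \forall w \ae P, forall x : R, Phi w [set x] <= 1.

Definition stationary_point_process {d} {Omega : measurableType d}
    {R : realType} (theta : R -> Omega -> Omega)
    (Phi : R.-ker Omega ~> measurableTypeR R) : Prop :=
  forall t w (B : set R), measurable B ->
    Phi (theta t w) B = Phi w [set (x + t)%R | x in B].

Definition intensity {d} {Omega : measurableType d} {R : realType}
    (P : probability Omega R) (Phi : R.-ker Omega ~> measurableTypeR R)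
    : \bar R :=
  \int[P]_w Phi w `]0%R, 1%R]%classic.

Definition palm {d} {Omega : measurableType d} {R : realType}
    (P : probability Omega R) (theta : R -> Omega -> Omega)
    (Phi : R.-ker Omega ~> measurableTypeR R) (A : set Omega) : \bar R :=
  (intensity P Phi)^-1 *
  \int[P]_w \int[Phi w]_(s in `]0%R, 1%R]) (\1_A (theta s w))%:E.

Section superposition.
Context {d} {Omega : measurableType d} {R : realType} {N : nat}.
Variable Phi : 'I_N -> R.-ker Omega ~> measurableTypeR R.

Definition superposition_set (w : Omega) (B : set (measurableTypeR R)) :
  \bar R := \sum_(i < N) Phi i w B.

Let superposition_set0 w : superposition_set w set0 = 0.
Proof. by rewrite /superposition_set big1. Qed.

Let superposition_set_ge0 w B : 0 <= superposition_set w B.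
Proof. by apply: sume_ge0. Qed.

Let superposition_set_sigma_additive w :
  semi_sigma_additive (superposition_set w).
Proof.
move=> F mF tF mUF; rewrite [X in _ --> X](_ : _ =
    lim ((fun n => \sum_(0 <= i < n) superposition_set w (F i)) @ \oo)).
  by apply: is_cvg_ereal_nneg_natsum => k _; exact: sume_ge0.
rewrite nneseries_sum//; apply: eq_bigr => /= i _.
exact: measure_semi_bigcup.
Qed.

HB.instance Definition _ w := isMeasure.Build _ _ _ (superposition_set w)
  (superposition_set0 w) (superposition_set_ge0 w)
  (@superposition_set_sigma_additive w).

Definition superposition (w : Omega) :
  {measure set (measurableTypeR R) -> \bar R} := superposition_set w.

Let measurable_superposition B : measurable B ->
  measurable_fun [set: Omega] (superposition ^~ B).
Proof.
by move=> mB; apply: emeasurable_sum => i; exact/measurable_kernel.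
Qed.

HB.instance Definition _ := isKernel.Build _ _ _ _ _
  superposition measurable_superposition.

End superposition.

(** [independent P G]: mutual independence of a finite family of systems of
    events, as the product rule over every subfamily. *)
Definition independent {d} {Omega : measurableType d} {R : realType}
    (P : probability Omega R) {I : finType} (G : I -> set (set Omega)) : Prop :=
  forall (J : {set I}) (A : I -> set Omega), (forall i, i \in J -> G i (A i)) ->
    P (\bigcap_(i in [set` J]) A i) = \prod_(i in J) P (A i).

Definition sigma_point_process {d} {Omega : measurableType d} {R : realType}
    (Phi : R.-ker Omega ~> measurableTypeR R) : set (set Omega) :=
  <<s \bigcup_(B in [set B : set R | measurable B])
        preimage_set_system setT (Phi ^~ B) measurable >>.

(** Filtrations are indexed by the real line and consist of sub-sigma-algebras
    represented by their sets of events.  [X] is measurable with respect to [G]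
    when its preimage system is included in [G]. *)

Definition filtration {d} {Omega : measurableType d} {R : realType}
    (F : R -> set (set Omega)) : Prop :=
  [/\ forall t, sigma_algebra setT (F t), forall t, F t `<=` measurable &
      forall s t, (s <= t)%R -> F s `<=` F t].

Definition history {d} {Omega : measurableType d} {R : realType}
    (F : R -> set (set Omega)) (Phi : R.-ker Omega ~> measurableTypeR R)
    : Prop :=
  filtration F /\ forall a b t : R, (a < b)%R -> (b <= t)%R ->
    preimage_set_system setT (fun w => Phi w `]a, b]%classic) measurable
      `<=` F t.

Definition natural_history {d} {Omega : measurableType d} {R : realType}
    (Phi : R.-ker Omega ~> measurableTypeR R) (t : R) : set (set Omega) :=
  <<s \bigcup_(ab in [set ab : R * R | (ab.1 < ab.2)%R /\ (ab.2 <= t)%R])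
        preimage_set_system setT (fun w => Phi w `]ab.1, ab.2]%classic)
          measurable >>.

Lemma natural_history_history {d} {Omega : measurableType d} {R : realType}
    (Phi : R.-ker Omega ~> measurableTypeR R) :
  history (natural_history Phi) Phi.
Proof.
split; first split.
- by move=> t; exact: smallest_sigma_algebra.
- rewrite /natural_history => t.
  apply: smallest_sub; first exact: sigma_algebra_measurable.
  move=> _ [[a b] _] /= [V mV <-].
  have mPhi : measurable_fun setT (fun w => Phi w `]a, b]%classic).
    by apply/measurable_kernel; exact: measurable_itv.
  exact: mPhi.
- rewrite /natural_history => s t st.
  apply: smallest_sub; first exact: smallest_sigma_algebra.
  move=> A [[a b] /= [ab bs] ?]; apply: sub_gen_smallest.
  by exists (a, b) => //=; split => //; exact: le_trans st.
rewrite /natural_history => a b t ab bt A HA; apply: sub_gen_smallest.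
by exists (a, b).
Qed.

Lemma natural_history_min {d} {Omega : measurableType d} {R : realType}
    (Phi : R.-ker Omega ~> measurableTypeR R) (F : R -> set (set Omega)) :
  history F Phi -> forall t, natural_history Phi t `<=` F t.
Proof.
move=> [[sF _ _] hF] t; apply: smallest_sub; first exact: sF.
by move=> A [[a b] /= [ab bt]]; exact: hF.
Qed.

Definition joint_history {d} {Omega : measurableType d} {R : realType}
    {N : nat} (Phi : 'I_N -> R.-ker Omega ~> measurableTypeR R) (t : R)
    : set (set Omega) :=
  <<s \bigcup_(i in [set: 'I_N]) natural_history (Phi i) t >>.

Definition predictable_sigma {Omega : Type} {R : realType}
    (F : R -> set (set Omega)) : set (set (R * Omega)) :=
  <<s [set D | exists a b A,
        [/\ (a < b)%R, F a A & D = `]a, b]%classic `*` A]] >>.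

(** [M] is the sigma-algebra of the state space [T]. *)
Definition predictable {Omega T : Type} {R : realType}
    (F : R -> set (set Omega)) (M : set (set T)) (X : R -> Omega -> T) : Prop :=
  preimage_set_system setT (fun x => X x.1 x.2) M `<=` predictable_sigma F.

Definition adapted {Omega T : Type} {R : realType}
    (F : R -> set (set Omega)) (M : set (set T)) (X : R -> Omega -> T) : Prop :=
  forall t, preimage_set_system setT (X t) M `<=` F t.

(** [Y] is a version of the conditional expectation [E[X | G]]. *)
Definition cond_expectation {d} {Omega : measurableType d} {R : realType}
    (P : probability Omega R) (G : set (set Omega)) (X Y : Omega -> \bar R)
    : Prop :=
  preimage_set_system setT Y measurable `<=` G /\
  forall A, G A -> \int[P]_(w in A) Y w = \int[P]_(w in A) X w.

(** The last clause is [E[Phi(]s, t]) | F_s] = E[\int_s^t lam(u) du | F_s]],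
    conditional expectations being defined up to almost sure equality. *)
Definition stochastic_intensity {d} {Omega : measurableType d} {R : realType}
    (P : probability Omega R) (F : R -> set (set Omega))
    (Phi : R.-ker Omega ~> measurableTypeR R) (lam : R -> Omega -> R) : Prop :=
  [/\ forall t w, (0 <= lam t w)%R,
      forall a b : R, \forall w \ae P,
        (@lebesgue_measure R).-integrable `]a, b] (fun u => (lam u w)%:E),
      adapted F measurable lam &
      forall s t : R, (s < t)%R -> exists Y : Omega -> \bar R,
        cond_expectation P (F s) (fun w => Phi w `]s, t]%classic) Y /\
        cond_expectation P (F s)
          (fun w => \int[@lebesgue_measure R]_(u in `]s, t]) (lam u w)%:E) Y].

(** Items are ['I_N]; [C] is the memory capacity. *)

Definition memory_states (N C : nat) : {set {set 'I_N}} :=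
  finset (fun S : {set 'I_N} => (#|S| <= C)%N).

(** The state space carries its discrete sigma-algebra. *)
Definition causal_policy {Omega : Type} {R : realType} {N : nat} (C : nat)
    (theta : R -> Omega -> Omega) (F : R -> set (set Omega))
    (pol : R -> Omega -> {set 'I_N}) : Prop :=
  [/\ forall t w, pol t w \in memory_states N C,
      stationary_process theta pol &
      predictable F [set: set {set 'I_N}] pol].

Definition hit_process {d} {Omega : measurableType d} {R : realType} {N : nat}
    (Phi : 'I_N -> R.-ker Omega ~> measurableTypeR R)
    (pol : R -> Omega -> {set 'I_N}) (w : Omega) (B : set R) : \bar R :=
  \sum_(i < N) \int[Phi i w]_(t in B) (i \in pol t w)%:R%:E.

Definition hit_rate {d} {Omega : measurableType d} {R : realType} {N : nat}
    (P : probability Omega R)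
    (Phi : 'I_N -> R.-ker Omega ~> measurableTypeR R)
    (pol : R -> Omega -> {set 'I_N}) : \bar R :=
  \int[P]_w hit_process Phi pol w `]0%R, 1%R].

Definition hit_probability {d} {Omega : measurableType d} {R : realType}
    {N : nat} (P : probability Omega R) (theta : R -> Omega -> Omega)
    (Phi : 'I_N -> R.-ker Omega ~> measurableTypeR R)
    (pol : R -> Omega -> {set 'I_N}) : \bar R :=
  palm P theta (superposition Phi)
    [set w | hit_process Phi pol w [set 0%R] = 1].

Definition policy_intensity {Omega : Type} {R : realType} {N : nat}
    (lam : 'I_N -> R -> Omega -> R) (pol : R -> Omega -> {set 'I_N})
    (t : R) (w : Omega) : R :=
  (\sum_(i < N) lam i t w * (i \in pol t w)%:R)%R.

Definition argmax_states {R : realType} (N C : nat) (v : 'I_N -> R) :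
    {set {set 'I_N}} :=
  finset (fun S : {set 'I_N} => (S \in memory_states N C) &&
    [forall T in memory_states N C,
      (\sum_(i in T) v i <= \sum_(i in S) v i)%R]).

(** A deterministic tie-breaking rule selects one of the maximizers. *)
Definition tie_breaking (T : finType) (sel : {set T} -> T) : Prop :=
  forall A : {set T}, A != finset.set0 -> sel A \in A.

Definition optimal_policy {Omega : Type} {R : realType} {N : nat} (C : nat)
    (sel : {set {set 'I_N}} -> {set 'I_N}) (lam : 'I_N -> R -> Omega -> R)
    (t : R) (w : Omega) : {set 'I_N} :=
  sel (argmax_states C (fun i => lam i t w)).

(* Main.v *)
Require Import Defs.
From HB Require Import structures.
From mathcomp Require Import all_boot all_order all_algebra.
From mathcomp Require Import all_classical all_reals all_analysis.
From mathcomp Require Import measurable_realfun.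

(** A predictable set of pairs (t, omega) is generated by rectangles ]a, b] x A
    with A in the joint history at time a, and such an A is generated by
    intersections of events of the individual histories.  On these, independence
    reduces the defining property of [lam i] (relative to the history of [Phi i]
    alone) to a product formula, so a pi-lambda argument gives
    E[Phi_i-mass of D] = E[\int 1_D lam_i dt] for every predictable D.
    Stationarity turns the right-hand side into an expectation at time 0, and
    the comparison of hit rates becomes a pointwise comparison of sums of
    intensities.  For the hit probability, independent stationary processes
    almost surely share no point: on a grid of mesh h the mean number of cells
    hit by both is at most [h * lambda_i * lambda_j].  Hence the Palm integral
    counts the hits in ]0, 1], and the hit probability is the hit rate divided
    by the total intensity. *)

Set Implicit Arguments.
Unset Strict Implicit.
Unset Printing Implicit Defensive.
Import Order.TTheory GRing.Theory Num.Theory.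
Import numFieldNormedType.Exports.

Local Open Scope classical_set_scope.
Local Open Scope ring_scope.
Local Open Scope ereal_scope.

(** * Uniqueness of finite measures, and integer-valued measures on the line *)

(** Dynkin's pi-lambda argument. [m1] and [m2] are bare set functions, countably additive only on
    [<<s G>>], so that the result applies directly to expectations seen as functions of a set. The
    total masses are compared separately because [setT] need not lie in [G]; finiteness of [m1 setT]
    permits the subtraction that handles complements. *)
Lemma sigma_additive_unique (T : Type) (R : realType) (G : set (set T))
    (m1 m2 : set T -> \bar R) :
  setI_closed G ->
  (forall A, 0 <= m1 A) -> (forall A, 0 <= m2 A) ->
  m1 set0 = 0 -> m2 set0 = 0 ->
  (forall F : (set T)^nat, trivIset setT F -> (forall k, <<s G >> (F k)) ->
    m1 (\bigcup_k F k) = \sum_(k <oo) m1 (F k)) ->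
  (forall F : (set T)^nat, trivIset setT F -> (forall k, <<s G >> (F k)) ->
    m2 (\bigcup_k F k) = \sum_(k <oo) m2 (F k)) ->
  m1 setT = m2 setT -> m1 setT < +oo ->
  (forall A, G A -> m1 A = m2 A) ->
  forall A, <<s G >> A -> m1 A = m2 A.
Proof.
move=> IG m1_ge0 m2_ge0 m10 m20 m1U m2U m12T m1T m12G.
have sG := smallest_sigma_algebra setT G.
have sGC A : <<s G >> A -> <<s G >> (~` A).
  by rewrite -setTD; case: sG => _ + _; exact.
have sGT : <<s G >> setT by case: sG => + _ _ => /sGC; rewrite setC0.
have mC (m : set T -> \bar R) A : (forall A, 0 <= m A) -> m set0 = 0 ->
    (forall F : (set T)^nat, trivIset setT F -> (forall k, <<s G >> (F k)) ->
    m (\bigcup_k F k) = \sum_(k <oo) m (F k)) ->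
    <<s G >> A -> m setT = m A + m (~` A).
  move=> m_ge0 m0 mU sA.
  (* Countable additivity is applied to [A], its complement and then empty sets only. *)
  have := mU (bigcup2 A (~` A)).
  rewrite bigcup2E setUCr => ->; last 2 first.
  - by rewrite -trivIset_bigcup2 setICr.
  - by move=> [|[|k]] /=; [exact: sA|exact: sGC|case: sG].
  rewrite (nneseries_split _ 2)//.
  rewrite [X in _ + X]eseries0; last by move=> [|[|k]] /=; rewrite ?m0.
  rewrite adde0.
  by rewrite add0n unlock /= adde0.
pose D := [set A | <<s G >> A /\ m1 A = m2 A].
have DD : dynkin D.
  split => //.
  - move=> A [sA m12A]; split; first exact: sGC.
    have fA : m1 A \is a fin_num.
      rewrite ge0_fin_numE//; apply: le_lt_trans m1T.
      by rewrite (mC m1 A)// leeDl.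
    have := m12T; rewrite (mC m1 A)// (mC m2 A)// -m12A => /(congr1 (fun x => x - m1 A)).
    by rewrite ![m1 A + _]addeC !addeK.
  - move=> F tF DF; split.
      by case: sG => _ _; apply => k; have [] := DF k.
    rewrite m1U ?m2U//; try by move=> k; have [] := DF k.
    by apply: eq_eseriesr => k _; have [] := DF k.
move=> A; rewrite -setI_closed_g_dynkin_g_sigma_algebra// => /(_ D)[]//.
split => // B GB; split; [exact: sub_gen_smallest|exact: m12G].
Qed.

Lemma sub_itvoc_bounded (R : realType) (a b : R) (B : set R) :
  B `<=` `]a, b]%classic -> bounded_set B.
Proof.
move=> Bab; exists (`|a| + `|b|)%R; split; first exact: num_real.
move=> x abx y /Bab/=; rewrite in_itv/= => /andP[ay yb].
apply/ltW/(le_lt_trans _ abx); rewrite ler_norml; apply/andP; split.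
  rewrite (le_trans _ (ltW ay))// opprD.
  by rewrite (le_trans _ (lerNnormlW (lexx `|a|%R)))// lerBlDr lerDl.
by rewrite (le_trans yb)// (le_trans (ler_norm b))// lerDr.
Qed.

(* If [mu D >= 1], then the infimum of the [s] such that
   [mu (D `&` `]-oo, s]) >= 1] is an atom of [mu] in [D]. *)
Lemma diffuse_integer_measure0 (R : realType)
    (mu : {measure set (measurableTypeR R) -> \bar R}) (a b : R) (D : set R) :
  (forall B : set R, measurable B -> bounded_set B ->
    exists n : nat, mu B = n%:R%:E) ->
  measurable D -> D `<=` `]a, b]%classic ->
  (forall x, D x -> mu [set x] < 1) -> mu D = 0.
Proof.
move=> muN mD Dab mu1.
have mDI (i : interval R) : measurable (D `&` [set` i]).
  by apply: measurableI => //; exact: measurable_itv.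
have bD (B : set R) : B `<=` D -> bounded_set B.
  by move=> BD; apply: (@sub_itvoc_bounded _ a b); exact: subset_trans Dab.
(* Values on bounded sets are natural numbers, so a mass below 1 is zero. *)
have muD_lt1 (B : set R) : measurable B -> B `<=` D -> mu B < 1 -> mu B = 0.
  move=> mB /bD bB; have [n ->] := muN _ mB bB.
  by rewrite lte_fin (ltr_nat _ n 1) ltnS leqn0 => /eqP ->.
pose E := [set s | 1 <= mu (D `&` `]-oo, s]%classic)].
have [D1|] := leP 1 (mu D); last by move=> /muD_lt1; exact.
exfalso.
have Eb : E b.
  rewrite /E/= (_ : _ `&` _ = D)//; apply/setIidPl => x /Dab/=.
  by rewrite !in_itv/= => /andP[].
have Ea x : E x -> (a < x)%R.
  rewrite ltNge; apply: contraPN => xa.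
  rewrite /E /= (_ : _ `&` _ = set0) ?measure0.
    by rewrite leNgt lte01.
  apply/seteqP; split => // y [/Dab/=].
  by rewrite !in_itv/= => /andP[ay _] /le_trans/(_ xa); rewrite leNgt ay.
have infE : has_inf E by split; [exists b|exists a => x /Ea/ltW].
pose x := inf E.
have Egt s : (x < s)%R -> 1 <= mu (D `&` `]-oo, s]%classic).
  move=> xs; have [t Et ts] := inf_lt (proj1 infE) xs.
  apply: (le_trans Et); apply: le_measure.
  - by rewrite inE; exact: mDI.
  - by rewrite inE; exact: mDI.
  apply: setIS => y /=; rewrite !in_itv/= => yt; exact: le_trans (ltW ts).
have Elt s : (s < x)%R -> mu (D `&` `]-oo, s]%classic) = 0.
  move=> sx; apply: muD_lt1 => //; rewrite ltNge; apply: contraTN sx => Es.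
  by rewrite -leNgt; apply: ge_inf => //; case: infE.
have Dx : D `&` `]-oo, x]%classic = \bigcap_n (D `&` `]-oo, (x + n.+1%:R^-1)%R]%classic).
  apply/seteqP; split => [y [Dy /=]|y Dy].
    rewrite in_itv/= => yx n _; split => //=; rewrite in_itv/=.
    by rewrite (le_trans yx)// lerDl.
  have [? _] := Dy O I; split => //=; rewrite in_itv/=.
  apply/ler_addgt0Pl => e e0.
  have xe : (x < x + e)%R by rewrite ltrDl.
  have [n ne] := ltr_add_invr xe.
  have [_ ] := Dy n I; rewrite /= in_itv/= => yn.
  by rewrite addrC (le_trans yn)// ltW.
(* Continuity from above: the mass is at least 1 on every half-line ending to the right of [x],
   hence also on the one ending at [x]. *)
have muDx : 1 <= mu (D `&` `]-oo, x]%classic).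
  have cv : (fun n => mu (D `&` `]-oo, (x + n.+1%:R^-1)%R]%classic)) @ \oo -->
      mu (D `&` `]-oo, x]%classic).
    rewrite Dx; apply: nonincreasing_cvg_mu => //.
    - have [|n] := muN _ (mDI `]-oo, (x + 1%:R^-1)%R]).
        by apply: bD; exact: subIsetl.
      by move=> /= ->; exact: ltry.
    - by move=> n; exact: mDI.
    - by rewrite -Dx; exact: mDI.
    - move=> m n mn; apply/subsetPset; apply: setIS => y /=; rewrite !in_itv/=.
      by move=> /le_trans; apply; rewrite lerD2l lef_pV2 ?posrE// ler_nat.
  apply: cvge_to_ge cv _.
  by apply: nearW => n; apply: Egt; rewrite ltrDl.
(* Half-lines ending strictly before [x] are null, and countably many of them exhaust the open
   half-line. *)
have muDltx : mu (D `&` `]-oo, x[%classic) = 0.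
  have -> : D `&` `]-oo, x[%classic = \bigcup_n (D `&` `]-oo, (x - n.+1%:R^-1)%R]%classic).
    apply/seteqP; split => [y [Dy /=]|y [n _ [Dy]]/=].
      rewrite in_itv/= => yx.
      have [n ne] := ltr_add_invr yx.
      by exists n => //; split => //=; rewrite in_itv/= lerBrDr ltW.
    rewrite in_itv/= => yx; split => //=; rewrite in_itv/= (le_lt_trans yx)//.
    by rewrite ltrBlDr ltrDl.
  apply: measure_negligible; first by apply: bigcupT_measurable => n; exact: mDI.
  apply: negligible_bigcup => n; apply/negligibleP; first exact: mDI.
  by apply: Elt; rewrite ltrBlDr ltrDl.
have : mu (D `&` [set x]) < 1.
  have [Dx'|Dx'] := pselect (D x).
    apply: (le_lt_trans _ (mu1 _ Dx')); apply: le_measure.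
    - by rewrite inE; apply: measurableI => //; exact: measurable_set1.
    - by rewrite inE; exact: measurable_set1.
    - exact: subIsetr.
  rewrite (_ : _ `&` _ = set0) ?measure0 ?lte01//.
  by apply/seteqP; split => // y [Dy /= yx]; apply: Dx'; rewrite -yx.
(* The mass up to [x] is at least 1, yet it is bounded by that of the null open part plus that of
   the point [x], which is below 1. *)
apply/negP; rewrite -leNgt; apply: (le_trans muDx).
rewrite (_ : D `&` `]-oo, x] = (D `&` `]-oo, x[) `|` (D `&` [set x])); last first.
  by rewrite -setIUr setUitv1.
apply: (le_trans (measureU2 _ _ _)).
- exact: mDI.
- by apply: measurableI => //; exact: measurable_set1.
- by rewrite [X in X + _]muDltx add0e.
Qed.

(** * Flows and kernels *)

Section flow.
Context {d} {Omega : measurableType d} {R : realType}.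
Variables (P : probability Omega R) (theta : R -> Omega -> Omega).
Hypothesis flow_theta : measurable_flow P theta.

Lemma measurable_flow_time t : measurable_fun setT (theta t).
Proof.
have [mtheta _ _ _] := flow_theta.
exact: (@measurable_fun_pair2 _ _ _ _ _ _ (fun x => theta x.1 x.2) t).
Qed.

Lemma ge0_integral_flow t (f : Omega -> \bar R) :
  measurable_fun setT f -> (forall w, 0 <= f w) ->
  \int[P]_w f (theta t w) = \int[P]_w f w.
Proof.
move=> mf f0; have [_ _ _ Ptheta] := flow_theta.
have mt := measurable_flow_time t.
rewrite -[LHS](@ge0_integral_pushforward _ _ _ _ _ _ mt P setT f)//.
by apply: eq_measure_integral => A mA _; exact: Ptheta.
Qed.

Variable Phi : R.-ker Omega ~> measurableTypeR R.
Hypothesis stat_Phi : stationary_point_process theta Phi.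

Lemma mean_itv_shift a h :
  \int[P]_w Phi w `]a, (a + h)%R]%classic = \int[P]_w Phi w `]0%R, h]%classic.
Proof.
rewrite -[RHS](ge0_integral_flow a); last 2 first.
- by apply/measurable_kernel; exact: measurable_itv.
- by [].
apply: eq_integral => w _; rewrite stat_Phi; last exact: measurable_itv.
congr (Phi w _); apply/seteqP; split => x /=; rewrite !in_itv/=.
  move=> /andP[ax xah]; exists (x - a)%R; last by rewrite subrK.
  by rewrite in_itv/= subr_gt0 ax lerBlDl.
by move=> [y + <-]; rewrite in_itv/= ltrDr addrC lerD2l.
Qed.

(** Additivity over [n] consecutive cells, each of the same mean by translation. With [n * h = 1]
    this evaluates the mean number of points in a grid cell. *)
Lemma mean_itv_mul n h : (0 <= h)%R ->
  \int[P]_w Phi w `]0%R, (n%:R * h)%R]%classic =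
  n%:R%:E * \int[P]_w Phi w `]0%R, h]%classic.
Proof.
move=> h0; elim: n => [|n IH].
  rewrite mul0r mul0e (_ : (fun _ => _) = cst 0) ?integral0//.
  by apply/funext => w; rewrite set_itvoc0 measure0.
have mPhi a b : measurable_fun setT (fun w => Phi w `]a, b]%classic).
  by apply/measurable_kernel; exact: measurable_itv.
rewrite -natr1 mulrDl mul1r EFinD ge0_muleDl//.
rewrite mul1e -{}IH -(mean_itv_shift (n%:R * h) h) -ge0_integralD//.
apply: eq_integral => w _; rewrite -measureU; try exact: measurable_itv.
  congr (Phi w _); rewrite -itv_bndbnd_setU// bnd_simp.
    by rewrite mulr_ge0.
  by rewrite lerDl.
apply/seteqP; split => // x [/=]; rewrite !in_itv/= => /andP[_ xn] /andP[nx _].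
by have := lt_le_trans nx xn; rewrite ltxx.
Qed.

End flow.

(** Restriction to a bounded interval makes each measure of the kernel finite, as the general result
    on sections requires. Time is the first coordinate of [D] but the variable of the measure, hence
    the swap. *)
Lemma measurable_kernel_ysection {d} {Omega : measurableType d} {R : realType}
    (Phi : R.-ker Omega ~> measurableTypeR R) (a b : R) (D : set (R * Omega)) :
  point_process Phi -> measurable D ->
  measurable_fun setT (fun w => Phi w (`]a, b]%classic `&` ysection D w)).
Proof.
move=> ppPhi mD.
have mab : measurable (`]a, b]%classic : set (measurableTypeR R)) by exact: measurable_itv.
pose A := (@unstable.swap _ _ @^-1` D) : set (Omega * measurableTypeR R).
have mA : measurable A by rewrite -[A]setTI; exact: measurable_swap.
have bPhi w : exists M : R, forall X, measurable X -> mrestr (Phi w) mab X < M%:E.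
  have [|n nE] := ppPhi w _ mab; first exact: (@sub_itvoc_bounded _ a b).
  (* The added 1 makes the bound strict. *)
  exists (n%:R + 1)%R => X mX; rewrite /mrestr.
  apply: (@le_lt_trans _ _ n%:R%:E); last by rewrite lte_fin ltrDl.
  by rewrite -nE le_measure ?inE//; exact: measurableI.
have [_ +] := measurable_prod_subset_xsection_kernel bPhi mA.
apply: eq_measurable_fun => w _; rewrite /mrestr setIC; congr (Phi w (_ `&` _)).
Qed.

(** The integral of a nonnegative function is determined by its law on positive values, so the
    product rule for the events cut out of [A] by [X] suffices. [A] appears inside that rule because
    it may depend on [X]. *)
Lemma ge0_integral_indep {d} {Omega : measurableType d} {R : realType}
    (P : probability Omega R) (A B : set Omega) (X : Omega -> \bar R) :
  measurable A -> measurable B -> measurable_fun setT X ->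
  (forall w, 0 <= X w) ->
  (forall V, measurable V ->
    P ((A `&` X @^-1` V) `&` B) = P (A `&` X @^-1` V) * P B) ->
  \int[P]_(w in A `&` B) X w = P B * \int[P]_(w in A) X w.
Proof.
move=> mA mB mX X0 PAB.
have mXD D : measurable D -> measurable_fun setT (X \_ D).
  move=> mD; apply: (measurable_restrictT _ mD).1.
  exact: measurable_funTS.
pose XD D (mD : measurable D) : {mfun Omega >-> \bar R} :=
  HB.pack (X \_ D) (isMeasurableFun.Build _ _ _ _ _ (mXD D mD)).
(* Away from 0, the laws of [X \_ (A `&` B)] and of [X \_ A] differ by the
   factor [P B]. *)
pose pos : set (\bar R) := [set y | 0 < y].
have mpos : measurable pos by rewrite /pos -set_itvoy; exact: emeasurable_itv.
(* The value 0 taken off [D] by the extension of [X] is discarded by integrating over [pos]. *)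
have intE D (mD : measurable D) :
    \int[P]_(w in D) X w = \int[pushforward P (XD D mD)]_(y in pos) y.
  rewrite (ge0_integral_pushforward (mXD D mD) _ mpos)//; last first.
    by move=> y; rewrite inE => /ltW.
  rewrite [LHS]integral_mkcond [RHS]integral_mkcond; apply: eq_integral => w _.
  rewrite [RHS]patchE/=; case: ifPn => // /negP; rewrite inE /pos/= => /negP.
  rewrite -leNgt => XDw0; apply/eqP; rewrite eq_le {}XDw0/=.
  by rewrite patchE; case: ifPn.
have pushE D (mD : measurable D) V : V `<=` pos ->
    pushforward P (XD D mD) V = P (D `&` X @^-1` V).
  move=> Vpos; congr (P _); apply/seteqP; split => w /=.
    rewrite patchE; case: ifPn => [/set_mem //|_ /Vpos].
    by rewrite /pos/= ltxx.
  by move=> [Dw Vw]; rewrite patchE mem_set.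
have PBE : P B = (fine (P B))%:E by rewrite fineK// fin_num_measure.
have PB0 : (0 <= fine (P B))%R by exact: fine_ge0.
rewrite (intE _ (measurableI _ _ mA mB)) (intE _ mA) {1}PBE.
rewrite -(@ge0_integral_mscale _ _ _ _ pos mpos (NngNum PB0) id)//; last first.
  by move=> y /ltW.
apply: eq_measure_integral => V mV Vpos.
rewrite [LHS](pushE _ (measurableI _ _ mA mB) _ Vpos).
transitivity (P B * P (A `&` X @^-1` V)).
  by rewrite muleC -PAB//; congr (P _); rewrite setIAC.
by rewrite [in LHS]PBE -(pushE _ mA _ Vpos).
Qed.

(** * Tonelli's theorem on rectangles of time and sample space *)

Section rectangle.
Context {d} {Omega : measurableType d} {R : realType}.
Variables (P : probability Omega R) (f : R * Omega -> \bar R).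
Hypotheses (mf : measurable_fun setT f) (f0 : forall z, 0 <= f z).
Variables (I : set R) (A : set Omega).
Hypotheses (mI : measurable I) (mA : measurable A).

Let mu : {sigma_finite_measure set (measurableTypeR R) -> \bar R} :=
  @lebesgue_measure R.

Let g := f \_ (I `*` A).

Let g0 z : 0 <= g z. Proof. by rewrite /g patchE; case: ifPn. Qed.

Let mg : measurable_fun setT g.
Proof.
apply: (measurable_restrictT _ (measurableX mI mA)).1.
exact: measurable_funTS.
Qed.

(** Extension by zero off the rectangle reduces this to Tonelli on the whole product. Combined with
    [integral_rectangle], it exchanges the time integral with the integral over an event. *)
Lemma integral_rectangle_flip :
  \int[mu \x P]_(z in I `*` A) f z =
  \int[P]_(w in A) \int[mu]_(u in I) f (u, w).
Proof.
rewrite integral_mkcond [LHS](@fubini_tonelli2 _ _ _ _ _ mu P g)//.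
rewrite [RHS]integral_mkcond; apply: eq_integral => w _.
rewrite /fubini_G patchE; case: ifPn => [wA|wA].
  rewrite [RHS]integral_mkcond; apply: eq_integral => u _.
  rewrite /g !patchE; have [uI|uI] := boolP (u \in I).
    by rewrite mem_set//; split; exact: set_mem.
  by case: ifPn => // /set_mem[/= /mem_set]; rewrite (negbTE uI).
rewrite (_ : (fun _ => _) = cst 0) ?integral0//; apply/funext => u.
by rewrite /g patchE; case: ifPn => // /set_mem[_ /= /mem_set]; rewrite (negbTE wA).
Qed.

Lemma integral_rectangle :
  \int[mu \x P]_(z in I `*` A) f z =
  \int[mu]_(u in I) \int[P]_(w in A) f (u, w).
Proof.
rewrite integral_mkcond [LHS](@fubini_tonelli1 _ _ _ _ _ mu P g)//.
rewrite [RHS]integral_mkcond; apply: eq_integral => u _.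
rewrite /fubini_F patchE; case: ifPn => [uI|uI].
  rewrite [RHS]integral_mkcond; apply: eq_integral => w _.
  rewrite /g !patchE; have [wA|wA] := boolP (w \in A).
    by rewrite mem_set//; split; exact: set_mem.
  by case: ifPn => // /set_mem[_ /= /mem_set]; rewrite (negbTE wA).
rewrite (_ : (fun _ => _) = cst 0) ?integral0//; apply/funext => w.
by rewrite /g patchE; case: ifPn => // /set_mem[/= /mem_set]; rewrite (negbTE uI).
Qed.

Lemma measurable_integral_slice :
  measurable_fun A (fun w => \int[mu]_(u in I) f (u, w)).
Proof.
have := @measurable_fun_fubini_tonelli_G _ _ _ _ _ mu g mg g0.
move/measurable_funTS => /(_ A); apply: eq_measurable_fun => w wA.
rewrite /fubini_G [RHS]integral_mkcond; apply: eq_integral => u _.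
rewrite /g !patchE; have [uI|uI] := boolP (u \in I).
  by rewrite mem_set//; split; exact: set_mem.
by case: ifPn => // /set_mem[/= /mem_set]; rewrite (negbTE uI).
Qed.

Lemma measurable_integral_section :
  measurable_fun I (fun u => \int[P]_(w in A) f (u, w)).
Proof.
have := @measurable_fun_fubini_tonelli_F _ _ _ _ _ P g mg g0.
move/measurable_funTS => /(_ I); apply: eq_measurable_fun => u uI.
rewrite /fubini_F [RHS]integral_mkcond; apply: eq_integral => w _.
rewrite /g !patchE; have [wA|wA] := boolP (w \in A).
  by rewrite mem_set//; split; exact: set_mem.
by case: ifPn => // /set_mem[_ /= /mem_set]; rewrite (negbTE wA).
Qed.

End rectangle.

(** * Histories and predictable sets *)

Section histories.
Context {d} {Omega : measurableType d} {R : realType}.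

Lemma sigma_point_process_measurable (Phi : R.-ker Omega ~> measurableTypeR R) :
  sigma_point_process Phi `<=` measurable.
Proof.
apply: smallest_sub; first exact: sigma_algebra_measurable.
move=> _ [B /= mB] [V mV <-].
by have := measurable_kernel Phi B mB; exact.
Qed.

Lemma natural_history_sub (Phi : R.-ker Omega ~> measurableTypeR R) t :
  natural_history Phi t `<=` sigma_point_process Phi.
Proof.
apply: smallest_sub; first exact: smallest_sigma_algebra.
move=> A [[a b] /= _ ABV]; apply: sub_gen_smallest.
by exists `]a, b]%classic => //=; exact: measurable_itv.
Qed.

Lemma predictable_sigma_measurable (F : R -> set (set Omega)) :
  (forall t, F t `<=` measurable) -> predictable_sigma F `<=` measurable.
Proof.
move=> Fm; apply: smallest_sub; first exact: sigma_algebra_measurable.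
move=> _ [a [b [A [_ FA ->]]]]; apply: measurableX; last exact: Fm FA.
exact: measurable_itv.
Qed.

Lemma predictable_measurable_fun (F : R -> set (set Omega)) (X : R -> Omega -> R) :
  (forall t, F t `<=` measurable) -> predictable F measurable X ->
  measurable_fun setT (fun z => X z.1 z.2).
Proof.
move=> Fm pX _ V mV; apply: (predictable_sigma_measurable Fm).
by apply: pX; exists V.
Qed.

End histories.

Section independent_processes.
Context {d} {Omega : measurableType d} {R : realType} {N : nat}.
Variables (P : probability Omega R) (Phi : 'I_N -> R.-ker Omega ~> measurableTypeR R).
Hypothesis indep_Phi : independent P (fun i => sigma_point_process (Phi i)).

(** The product rule is used for two subfamilies: all indices, with [E] in place [i], and all
    indices but [i]. The second product is the remaining factor of the first. *)
Lemma independent_others i (E : set Omega) (B : 'I_N -> set Omega) :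
  sigma_point_process (Phi i) E ->
  (forall j, sigma_point_process (Phi j) (B j)) ->
  P (E `&` \bigcap_(j in [set j | j != i]) B j) =
  P E * P (\bigcap_(j in [set j | j != i]) B j).
Proof.
move=> sE sB.
pose B' j := if j == i then E else B j.
have sB' j : sigma_point_process (Phi j) (B' j).
  by rewrite /B'; case: eqP => [->|].
have := indep_Phi (J := finset.setT) (fun j _ => sB' j).
rewrite (bigD1 i) ?finset.inE//= {2}/B' eqxx.
rewrite (eq_bigl (fun j => j != i)) => [EB|j]; last by rewrite !finset.inE.
have := indep_Phi (J := finset.setC (finset.set1 i)) (fun j _ => sB' j).
rewrite (eq_bigl (fun j => j != i)) => [EC|j]; last by rewrite !finset.inE.
have CE : \bigcap_(j in [set` finset.setC (finset.set1 i)]) B' j =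
    \bigcap_(j in [set j | j != i]) B j.
  apply: eq_bigcap => [|j] /=.
    by split => j /=; rewrite /= !finset.inE.
  by rewrite /= !finset.inE /B' => /negbTE ->.
rewrite -CE EC -EB; congr (P _); apply/seteqP; split => w /=.
  move=> [Ew Bw] j _; have [->|ji] := eqVneq j i; first by rewrite /B' eqxx.
  by apply: Bw => /=; rewrite !finset.inE.
move=> Bw; split; first by have := Bw i; rewrite /B' eqxx; apply=> /=; rewrite finset.inE.
by move=> j _; apply: Bw; rewrite /= finset.inE.
Qed.

End independent_processes.

Lemma sigma_algebra_setI {T : pointedType} (G : set (set T)) A B :
  sigma_algebra setT G -> G A -> G B -> G (A `&` B).
Proof.
by move=> sG; rewrite -(measurable_g_measurableTypeE sG); exact: measurableI.
Qed.

Lemma sigma_algebra_setT {T : pointedType} (G : set (set T)) :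
  sigma_algebra setT G -> G setT.
Proof.
by move=> sG; rewrite -(measurable_g_measurableTypeE sG); exact: measurableT.
Qed.

Section joint_history.
Context {d} {Omega : measurableType d} {R : realType} {N : nat}.
Variables (P : probability Omega R) (Phi : 'I_N -> R.-ker Omega ~> measurableTypeR R).

(** The union generating the joint history is in general not closed under intersection; taking one
    event per item gives a pi-system on which independence can be read off. *)
Definition history_cylinder t : set (set Omega) :=
  [set A | exists2 B : 'I_N -> set Omega,
    forall j, natural_history (Phi j) t (B j) & A = \bigcap_j B j].

Lemma sigma_algebra_natural_history i t :
  sigma_algebra setT (natural_history (Phi i) t).
Proof. exact: smallest_sigma_algebra. Qed.

Lemma natural_history_measurable i t : natural_history (Phi i) t `<=` measurable.
Proof.
by apply: subset_trans (@sigma_point_process_measurable _ _ _ _); exact: natural_history_sub.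
Qed.

Lemma joint_history_filtration : filtration (joint_history Phi).
Proof.
split => [t|t|s t st].
- exact: smallest_sigma_algebra.
- apply: smallest_sub; first exact: sigma_algebra_measurable.
  by apply: bigcup_sub => i _; exact: natural_history_measurable.
- apply: smallest_sub; first exact: smallest_sigma_algebra.
  move=> A [i _ iA]; apply: sub_gen_smallest; exists i => //.
  by have [[_ _ +] _] := natural_history_history (Phi i) => /(_ s t st A iA).
Qed.

Lemma natural_history_joint i t : natural_history (Phi i) t `<=` joint_history Phi t.
Proof. by move=> A iA; apply: sub_gen_smallest; exists i. Qed.

(** An event of one history is the cylinder with the whole space in all other places. *)
Lemma joint_history_cylinder t : joint_history Phi t `<=` <<s history_cylinder t >>.
Proof.
apply: smallest_sub; first exact: smallest_sigma_algebra.
move=> A [i _ iA]; apply: sub_gen_smallest.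
exists (fun j => if j == i then A else setT) => [j|].
  case: eqP => [->//|_].
  exact: sigma_algebra_setT (sigma_algebra_natural_history j t).
apply/seteqP; split => [w Aw j _|w /(_ i I)]; last by rewrite eqxx.
by case: ifP.
Qed.

Lemma history_cylinder_setI t : setI_closed (history_cylinder t).
Proof.
move=> _ _ [A hA ->] [B hB ->]; exists (fun j => A j `&` B j).
  move=> j; apply: sigma_algebra_setI (sigma_algebra_natural_history j t) _ _ => //.
by rewrite bigcapI.
Qed.

Lemma history_cylinder_measurable t : history_cylinder t `<=` measurable.
Proof.
move=> _ [B hB ->]; apply: fin_bigcap_measurable; first exact: finite_finset.
by move=> j _; exact: natural_history_measurable (hB j).
Qed.

Hypotheses (indep_Phi : independent P (fun i => sigma_point_process (Phi i)))
  (lam : 'I_N -> R -> Omega -> R)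
  (lam_intensity : forall i,
    stochastic_intensity P (natural_history (Phi i)) (Phi i) (lam i))
  (lam_predictable : forall i,
    predictable (natural_history (Phi i)) measurable (lam i)).

Let mu : {sigma_finite_measure set (measurableTypeR R) -> \bar R} :=
  @lebesgue_measure R.

Let lam_ge0 i t w : (0 <= lam i t w)%R.
Proof. by have [] := lam_intensity i. Qed.

Lemma measurable_intensity i :
  measurable_fun setT (fun z : R * Omega => (lam i z.1 z.2)%:E).
Proof.
apply/measurable_EFinP.
exact: predictable_measurable_fun (@natural_history_measurable i) (@lam_predictable i).
Qed.

(* The product formula is applied at each fixed time [u], under the time
   integral: [lam i u] is measurable with respect to [Phi i], which is not known
   of the time integral of [lam i]. *)
Lemma cylinder_intensity i s t A : (s < t)%R -> history_cylinder s A ->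
  \int[P]_(w in A) Phi i w `]s, t]%classic =
  \int[P]_(w in A) \int[mu]_(u in `]s, t]) (lam i u w)%:E.
Proof.
move=> st [B hB ->].
have sB j : sigma_point_process (Phi j) (B j) by exact: natural_history_sub (hB j).
have mB j : measurable (B j) by exact: sigma_point_process_measurable (sB j).
have sI j A1 A2 : sigma_point_process (Phi j) A1 -> sigma_point_process (Phi j) A2 ->
    sigma_point_process (Phi j) (A1 `&` A2).
  by apply: sigma_algebra_setI; exact: smallest_sigma_algebra.
(* [C] collects the conditions on the other items, so it is independent of whatever [Phi i]
   determines. *)
pose C := \bigcap_(j in [set j | j != i]) B j.
have mC : measurable C by apply: fin_bigcap_measurable => //; exact: finite_finset.
have -> : \bigcap_j B j = B i `&` C.
  apply/seteqP; split => [w Bw|w [Bw Cw] j _]; first by split => [|j _]; exact: Bw.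
  by have [->//|ji] := eqVneq j i; exact: Cw.
have mitv : measurable (`]s, t]%classic : set R) by exact: measurable_itv.
rewrite ge0_integral_indep//; last 2 first.
- exact/measurable_kernel.
- move=> V mV; apply: (independent_others indep_Phi) => //; refine (sI _ _ _ (sB i) _).
  apply: sub_gen_smallest; exists `]s, t]%classic => //.
  by exists V => //; rewrite setTI.
pose f (z : R * Omega) := (lam i z.1 z.2)%:E.
have mf : measurable_fun setT f by exact: measurable_intensity.
have f0 z : 0 <= f z by rewrite lee_fin.
have mBC : measurable (B i `&` C) by exact: measurableI.
rewrite -[RHS](integral_rectangle_flip _ mf f0)// (integral_rectangle _ mf f0)//.
have [_ _ adapted_lam cond_lam] := lam_intensity i.
(* [B i] belongs to the history of [Phi i] at [s], so the integrals of both sides over it equal that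
   of their common conditional expectation [Y]. *)
have [Y [[_ YPhi] [_ Ylam]]] := cond_lam _ _ st.
rewrite -YPhi// Ylam// -[X in P C * X](integral_rectangle_flip _ mf f0)//.
rewrite (integral_rectangle _ mf f0)// -ge0_integralZl//; last 2 first.
- exact: (measurable_integral_section _ mf f0).
- by move=> u _; exact: integral_ge0.
apply/esym.
apply: eq_integral => u _; apply: ge0_integral_indep => //.
- exact: (measurable_fun_pair2 u mf).
- move=> V mV; apply: (independent_others indep_Phi) => //.
  refine (sI _ _ _ (sB i) _).
  (* Adaptedness places [lam i u] in the history at [u], hence among the events of [Phi i], even for
     [u] after [s]. *)
  apply: (@natural_history_sub _ _ _ _ u); apply: adapted_lam.
  exists (EFin @^-1` V); last by rewrite setTI.
  by rewrite -[X in measurable X]setTI; exact: EFin_measurable.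
Qed.

End joint_history.

Lemma setI_itvoc (R : realType) (a b a' b' : R) :
  `]a, b]%classic `&` `]a', b']%classic =
  `](Num.max a a'), (Num.min b b')]%classic.
Proof.
apply/seteqP; split => x /=; rewrite !in_itv/= gt_max le_min.
  by move=> [/andP[-> ->] /andP[-> ->]].
by move=> /andP[/andP[-> ->] /andP[-> ->]].
Qed.

(** * The intensity formula on predictable sets *)

Section predictable_intensity.
Context {d} {Omega : measurableType d} {R : realType} {N : nat}.
Variables (P : probability Omega R) (Phi : 'I_N -> R.-ker Omega ~> measurableTypeR R).
Hypotheses (pp_Phi : forall i, point_process (Phi i))
  (indep_Phi : independent P (fun i => sigma_point_process (Phi i)))
  (intensity_Phi : forall i, intensity P (Phi i) < +oo)
  (lam : 'I_N -> R -> Omega -> R)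
  (lam_intensity : forall i,
    stochastic_intensity P (natural_history (Phi i)) (Phi i) (lam i))
  (lam_predictable : forall i,
    predictable (natural_history (Phi i)) measurable (lam i)).

Let mu : {sigma_finite_measure set (measurableTypeR R) -> \bar R} :=
  @lebesgue_measure R.

Let f i (z : R * Omega) := (lam i z.1 z.2)%:E.

Let mf i : measurable_fun setT (f i).
Proof. exact: measurable_intensity. Qed.

Let f0 i z : 0 <= f i z.
Proof. by rewrite lee_fin; have [] := lam_intensity i. Qed.

Let mPhi i s t : measurable_fun setT (fun w => Phi i w `]s, t]%classic).
Proof. by apply: measurable_kernel; exact: measurable_itv. Qed.

Let mitv s t : measurable (`]s, t]%classic : set R).
Proof. exact: measurable_itv. Qed.

(** The defining identity of the intensity passes from the history of [Phi i] to the joint one by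
    uniqueness of measures, starting from cylinders. Keeping []s, t]] inside []0, 1]] bounds the
    total mass by the finite intensity. *)
Lemma joint_intensity i s t A : (0 <= s)%R -> (s < t)%R -> (t <= 1)%R ->
  joint_history Phi s A ->
  \int[P]_(w in A) Phi i w `]s, t]%classic =
  \int[P]_(w in A) \int[mu]_(u in `]s, t]) f i (u, w).
Proof.
move=> s0 st t1 /joint_history_cylinder.
have sm : <<s history_cylinder Phi s >> `<=` measurable.
  apply: smallest_sub; first exact: sigma_algebra_measurable.
  exact: history_cylinder_measurable.
have cylE := @cylinder_intensity _ _ _ _ _ _ indep_Phi _ lam_intensity lam_predictable i _ _ _ st.
have cylT : history_cylinder Phi s setT.
  exists (fun _ => setT) => [j|]; last by rewrite bigcapT.
  exact: sigma_algebra_setT (sigma_algebra_natural_history Phi j s).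
have mL : measurable_fun setT (fun w => \int[mu]_(u in `]s, t]) f i (u, w)).
  exact: (measurable_integral_slice (@mf i) (f0 i) (mitv s t) measurableT).
pose m1 A := \int[P]_(w in A) Phi i w `]s, t]%classic.
pose m2 A := \int[P]_(w in A) \int[mu]_(u in `]s, t]) f i (u, w).
move: A; apply: (@sigma_additive_unique _ _ _ m1 m2).
- exact: history_cylinder_setI.
- by move=> A; exact: integral_ge0.
- by move=> A; apply: integral_ge0 => w _; exact: integral_ge0.
- by rewrite /m1 integral_set0.
- by rewrite /m2 integral_set0.
- move=> F tF sF; rewrite /m1 ge0_integral_bigcup//; first by move=> k; exact: sm.
  exact: measurable_funTS.
- move=> F tF sF; rewrite /m2 ge0_integral_bigcup//; first by move=> k; exact: sm.
    exact: measurable_funTS.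
  by move=> w _; exact: integral_ge0.
- exact: cylE.
- apply: le_lt_trans (intensity_Phi i); apply: ge0_le_integral => //.
  move=> w _; apply: le_measure; rewrite ?inE//.
  by apply: subset_itv; rewrite bnd_simp.
- exact: cylE.
Qed.

(** Both sides are measures in [D], finite because time is cut to []0, 1]], and [joint_intensity]
    gives their equality on the generating rectangles. *)
Lemma predictable_intensity i D : predictable_sigma (joint_history Phi) D ->
  \int[P]_w Phi i w (`]0%R, 1%R]%classic `&` ysection D w) =
  \int[mu \x P]_(z in (`]0%R, 1%R] `*` setT) `&` D) f i z.
Proof.
have [sF Fm Fmono] := joint_history_filtration Phi.
have pm := predictable_sigma_measurable Fm.
have m01 : measurable (`]0%R, 1%R] `*` setT : set (R * Omega)).
  exact: measurableX.
have F0 t : joint_history Phi t set0 by have [] := sF t.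
pose m1 (D : set (R * Omega)) := \int[P]_w Phi i w (`]0%R, 1%R]%classic `&` ysection D w).
pose m2 (D : set (R * Omega)) := \int[mu \x P]_(z in (`]0%R, 1%R] `*` setT) `&` D) f i z.
rewrite -/(m1 D) -/(m2 D).
have m1X J A : measurable A -> m1 (J `*` A) = \int[P]_(w in A) Phi i w (`]0%R, 1%R]%classic `&` J).
  move=> mA; rewrite [RHS]integral_mkcond; apply: eq_integral => w _; rewrite patchE.
  by case: ifPn => wA; [rewrite in_ysectionX|rewrite notin_ysectionX// setI0 measure0].
have m2X J A : measurable J -> measurable A ->
    m2 (J `*` A) = \int[P]_(w in A) \int[mu]_(u in `]0%R, 1%R] `&` J) f i (u, w).
  move=> mJ mA; rewrite /m2 -setXI setTI integral_rectangle_flip//.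
  exact: measurableI.
apply: (@sigma_additive_unique _ _ _ m1 m2).
- move=> _ _ [a [b [A [ab FA ->]]]] [a' [b' [A' [ab' FA' ->]]]].
  have [mab|mab] := ltP (Num.max a a') (Num.min b b').
    exists (Num.max a a'), (Num.min b b'), (A `&` A'); split => //.
      apply: sigma_algebra_setI (sF _) _ _.
        by apply: Fmono FA; rewrite le_max lexx.
      by apply: Fmono FA'; rewrite le_max lexx orbT.
    by rewrite -setXI setI_itvoc.
  (* When the time intervals do not overlap, the empty set still has to be exhibited as a rectangle
     with [a < b]: its event is taken empty. *)
  exists a, b, set0; split => //.
  by rewrite -setXI setI_itvoc set_itv_ge ?bnd_simp -?leNgt// set0X setX0.
- by move=> B; exact: integral_ge0.
- by move=> B; exact: integral_ge0.
- rewrite /m1 (_ : (fun _ => _) = cst 0) ?integral0//.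
  by apply/funext => w; rewrite ysection0 setI0 measure0.
- by rewrite /m2 setI0 integral_set0.
- move=> G tG sG; rewrite /m1 -integral_nneseries//; last first.
    by move=> k; apply: measurable_kernel_ysection => //; apply: pm; exact: sG.
  apply: eq_integral => w _; rewrite ysection_bigcup setI_bigcupr measure_bigcup//.
  + by apply: eq_eseriesl => k; rewrite in_setT.
  + move=> k _; apply: measurableI => //; apply: measurable_ysection.
    by apply: pm; exact: sG.
  + by apply: trivIset_setIl; exact: trivIset_ysection.
- move=> G tG sG; rewrite /m2 setI_bigcupr ge0_integral_bigcup//.
  + by move=> k; apply: measurableI => //; apply: pm; exact: sG.
  + exact: (measurable_funTS (@mf i)).
  + exact: trivIset_setIl.
- rewrite -setXTT m1X// m2X// !setIT; apply: joint_intensity => //.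
  exact: sigma_algebra_setT.
- rewrite -setXTT m1X// setIT; exact: intensity_Phi.
- move=> _ [a [b [A [ab FA ->]]]]; rewrite m1X ?m2X//; try exact: Fm FA.
  rewrite setI_itvoc.
  (* The rectangle cut to []0, 1]] starts at the maximum of 0 and [a], and the event known at [a] is
     still known then. If the cut is empty, both sides vanish. *)
  have [ab1|ab1] := ltP (Num.max 0%R a) (Num.min 1%R b).
    apply: joint_intensity => //; rewrite ?le_max ?lexx// ?ge_min ?lexx//.
    by apply: Fmono FA; rewrite le_max lexx orbT.
  rewrite set_itv_ge ?bnd_simp -?leNgt//; apply: eq_integral => w _.
  by rewrite measure0 integral_set0.
Qed.

End predictable_intensity.

(** * Hit rates *)

Section hit_rate.
Context {d} {Omega : measurableType d} {R : realType} {N : nat}.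
Variables (P : probability Omega R) (theta : R -> Omega -> Omega).
Hypothesis flow_theta : measurable_flow P theta.
Variable Phi : 'I_N -> R.-ker Omega ~> measurableTypeR R.
Hypotheses (pp_Phi : forall i, point_process (Phi i))
  (indep_Phi : independent P (fun i => sigma_point_process (Phi i)))
  (intensity_Phi : forall i, intensity P (Phi i) < +oo)
  (lam : 'I_N -> R -> Omega -> R)
  (lam_intensity : forall i,
    stochastic_intensity P (natural_history (Phi i)) (Phi i) (lam i))
  (lam_predictable : forall i,
    predictable (natural_history (Phi i)) measurable (lam i))
  (lam_stationary : forall i, stationary_process theta (lam i)).

Let f i (z : R * Omega) := (lam i z.1 z.2)%:E.

Let mf i : measurable_fun setT (f i).
Proof. exact: measurable_intensity. Qed.

Let f0 i z : 0 <= f i z.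
Proof. by rewrite lee_fin; have [] := lam_intensity i. Qed.

(** The second hypothesis says that the indicator of [D] is a stationary process, so the mean of the
    integrand is constant in time, and []0, 1]] has length 1. *)
Lemma stationary_rate i (D : set (R * Omega)) :
  predictable_sigma (joint_history Phi) D ->
  (forall t w, D (t, w) <-> D (0%R, theta t w)) ->
  \int[P]_w Phi i w (`]0%R, 1%R]%classic `&` ysection D w) =
  \int[P]_w (f i \_ D) (0%R, w).
Proof.
move=> pD statD.
have [_ Fm _] := joint_history_filtration Phi.
have mD : measurable D := predictable_sigma_measurable Fm pD.
rewrite (predictable_intensity pp_Phi indep_Phi intensity_Phi lam_intensity)//.
pose g := f i \_ D.
have mg : measurable_fun setT g.
  by apply: (measurable_restrictT _ mD).1; exact: (measurable_funTS (@mf i)).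
have g0 z : 0 <= g z by rewrite /g patchE; case: ifPn.
have m01 : measurable (`]0%R, 1%R]%classic : set R) by exact: measurable_itv.
rewrite integral_mkcondr (integral_rectangle P mg g0)//.
have gE t : \int[P]_w g (t, w) = \int[P]_w g (0%R, w).
  rewrite -[RHS](ge0_integral_flow flow_theta t) //; last first.
    exact: measurable_fun_pair2.
  apply: eq_integral => w _; rewrite /g !patchE.
  have -> : ((t, w) \in D) = ((0%R, theta t w) \in D).
    by apply/idP/idP => [/set_mem/statD/mem_set|/set_mem Dt]; [exact|apply/mem_set; apply/statD].
  by rewrite /f/= (lam_stationary _ t).
under eq_integral => t _ do rewrite gE.
transitivity ((\int[P]_w g (0%R, w)) * @lebesgue_measure R `]0%R, 1%R]).
  exact: (@integral_cst _ _ _ (@lebesgue_measure R)).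
rewrite [X in _ * X]lebesgue_measure_itv/= lte_fin ltr01.
by rewrite oppr0 adde0 mule1.
Qed.

Lemma measurable_policy C (pol : R -> Omega -> {set 'I_N}) i :
  causal_policy C theta (joint_history Phi) pol ->
  predictable_sigma (joint_history Phi) [set z | i \in pol z.1 z.2].
Proof.
move=> [_ _ ppol]; apply: ppol.
by exists [set S : {set 'I_N} | i \in S] => //; rewrite setTI.
Qed.

Lemma integral_policy C (pol : R -> Omega -> {set 'I_N}) i w (B : set R) :
  causal_policy C theta (joint_history Phi) pol -> measurable B ->
  \int[Phi i w]_(t in B) (i \in pol t w)%:R%:E =
  Phi i w (B `&` ysection [set z | i \in pol z.1 z.2] w).
Proof.
move=> cpol mB.
have [_ Fm _] := joint_history_filtration Phi.
have := predictable_sigma_measurable Fm (measurable_policy i cpol).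
move=> /(@measurable_ysection _ _ _ _ _ w) mD.
rewrite setIC -integral_indic//; apply: eq_integral => t _.
rewrite indicE mem_ysection; congr (_%:R%:E); congr nat_of_bool.
by apply/idP/idP => [?|/set_mem//]; exact/mem_set.
Qed.

Let policy_intensity_patch (pol : R -> Omega -> {set 'I_N}) t w :
  (policy_intensity lam pol t w)%:E =
  \sum_(i < N) (f i \_ [set z | i \in pol z.1 z.2]) (t, w).
Proof.
rewrite /policy_intensity -sumEFin; apply: eq_bigr => i _; rewrite patchE /f/=.
case: ifPn => [/set_mem/= ->|/negP]; first by rewrite mulr1.
by rewrite inE/= => /negP/negbTE ->; rewrite mulr0.
Qed.

Lemma measurable_policy_intensity C (pol : R -> Omega -> {set 'I_N}) t :
  causal_policy C theta (joint_history Phi) pol ->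
  measurable_fun setT (fun w => (policy_intensity lam pol t w)%:E).
Proof.
move=> cpol; under eq_fun do rewrite policy_intensity_patch.
apply: emeasurable_sum => i; apply: measurable_fun_pair2.
have [_ Fm _] := joint_history_filtration Phi.
have mD := predictable_sigma_measurable Fm (measurable_policy i cpol).
by apply: (measurable_restrictT _ mD).1; exact: (measurable_funTS (@mf i)).
Qed.

(** Each item contributes through [stationary_rate], applied to the set of pairs at which it is
    stored. *)
Lemma hit_rate_policy_intensity C (pol : R -> Omega -> {set 'I_N}) :
  causal_policy C theta (joint_history Phi) pol ->
  hit_rate P Phi pol = 'E_P[policy_intensity lam pol 0%R].
Proof.
move=> cpol; have [_ spol _] := cpol.
have [_ Fm _] := joint_history_filtration Phi.
pose D i : set (R * Omega) := [set z | i \in pol z.1 z.2].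
have pD i : predictable_sigma (joint_history Phi) (D i).
  exact: measurable_policy cpol.
have mD i : measurable (D i) := predictable_sigma_measurable Fm (@pD i).
transitivity (\sum_(i < N) \int[P]_w Phi i w (`]0%R, 1%R]%classic `&` ysection (D i) w)).
  rewrite -ge0_integral_sum//; last first.
    by move=> i; exact: measurable_kernel_ysection.
  apply: eq_integral => w _; apply: eq_bigr => i _.
  by rewrite (integral_policy _ _ cpol)//; exact: measurable_itv.
transitivity (\sum_(i < N) \int[P]_w (f i \_ (D i)) (0%R, w)).
  apply: eq_bigr => i _; apply: stationary_rate => // t w.
  by rewrite /D/= (spol t).
rewrite -ge0_integral_sum//; last 2 first.
- move=> i; apply: measurable_fun_pair2.
  by apply: (measurable_restrictT _ (mD i)).1; exact: (measurable_funTS (@mf i)).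
- by move=> i w _; rewrite patchE; case: ifPn.
rewrite expectation.unlock; apply: eq_integral => w _.
by rewrite policy_intensity_patch.
Qed.

End hit_rate.

(** * Policies of maximal total intensity *)

Section optimal_policy.
Context {R : realType} {N : nat}.
Variables (C : nat) (sel : {set {set 'I_N}} -> {set 'I_N}).
Hypothesis sel_ties : tie_breaking sel.

Lemma sel_argmax_states (v : 'I_N -> R) :
  sel (argmax_states C v) \in argmax_states C v.
Proof.
apply: sel_ties; apply/finset.set0Pn.
(* The empty memory fits any capacity, so the maximum is taken over a nonempty finite family. *)
have C0 : finset.set0 \in memory_states N C by rewrite finset.inE cards0.
have [S] := arg_maxP (fun S : {set 'I_N} => (\sum_(i in S) v i)%R) C0.
move=> SC0 Smax; have SC : S \in memory_states N C := SC0.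
exists S; rewrite finset.inE SC/=; apply/forall_inP => T TC; exact: Smax.
Qed.

Lemma policy_intensityE {Omega : Type} (lam : 'I_N -> R -> Omega -> R) pol t w :
  policy_intensity lam pol t w = (\sum_(i in pol t w) lam i t w)%R.
Proof.
rewrite /policy_intensity [RHS]big_mkcond; apply: eq_bigr => i _.
by case: ifP => _; rewrite ?mulr1 ?mulr0.
Qed.

Lemma optimal_policy_max {Omega : Type} (lam : 'I_N -> R -> Omega -> R) pol t w :
  pol t w \in memory_states N C ->
  (policy_intensity lam pol t w <=
   policy_intensity lam (optimal_policy C sel lam) t w)%R.
Proof.
move=> polC; rewrite !policy_intensityE.
have := sel_argmax_states (fun i => lam i t w).
by rewrite finset.inE => /andP[_ /forall_inP]; apply.
Qed.

(** The argmax has finitely many possible values, so the event is a finite union of events that fix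
    the membership of every state. The space is arbitrary so that it can carry the predictable
    sigma-algebra. *)
Lemma measurable_argmax_states {d} {T : measurableType d} (v : 'I_N -> T -> R)
    (Q : set {set {set 'I_N}}) :
  (forall i, measurable_fun setT (v i)) ->
  measurable [set x | Q (argmax_states C (v ^~ x))].
Proof.
move=> mv.
have msum (S : {set 'I_N}) : measurable_fun setT (fun x => \sum_(i in S) v i x)%R.
  under eq_fun do rewrite -big_filter.
  exact: measurable_sum.
have mS S : measurable [set x | S \in argmax_states C (v ^~ x)].
  have [SC|SC] := boolP (S \in memory_states N C); last first.
    rewrite (_ : mkset _ = set0)//; apply/seteqP; split => // x.
    by rewrite /= finset.inE (negbTE SC).
  rewrite (_ : mkset _ = \bigcap_(U in [set` memory_states N C])
      [set x | (\sum_(i in U) v i x <= \sum_(i in S) v i x)%R]).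
    apply: fin_bigcap_measurable => [|U _]; first exact: finite_finset.
    have := measurable_fun_ler (msum U) (msum S).
    by move=> /(_ measurableT [set true] I); rewrite setTI.
  apply/seteqP; split => x /=; rewrite finset.inE SC/=.
    by move=> /forall_inP SU U /= UC; exact: SU.
  by move=> SU; apply/forall_inP => U UC; exact: SU.
rewrite (_ : mkset _ = \bigcup_(A in Q)
    \bigcap_S [set x | (S \in argmax_states C (v ^~ x)) = (S \in A)]).
  apply: fin_bigcup_measurable => [|A _]; first exact: finite_finset.
  apply: fin_bigcap_measurable => [|S _]; first exact: finite_finset.
  case: (S \in A); first exact: mS.
  rewrite (_ : mkset _ = ~` [set x | S \in argmax_states C (v ^~ x)]).
    exact: measurableC.
  by apply/seteqP; split => x /=; [move=> ->|move=> /negP/negbTE].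
apply/seteqP; split => [x Qx|x [A QA AE]] /=.
  by exists (argmax_states C (v ^~ x)).
by rewrite (_ : argmax_states _ _ = A)//; apply/setP => S; exact: AE.
Qed.

End optimal_policy.

Lemma optimal_policy_causal {d} {Omega : measurableType d} {R : realType} {N : nat}
    (C : nat) (theta : R -> Omega -> Omega)
    (Phi : 'I_N -> R.-ker Omega ~> measurableTypeR R) (lam : 'I_N -> R -> Omega -> R)
    (sel : {set {set 'I_N}} -> {set 'I_N}) :
  (forall i, predictable (natural_history (Phi i)) measurable (lam i)) ->
  (forall i, stationary_process theta (lam i)) -> tie_breaking sel ->
  causal_policy C theta (joint_history Phi) (optimal_policy C sel lam).
Proof.
move=> lam_predictable lam_stationary sel_ties; split.
- move=> t w; have := sel_argmax_states C sel_ties (fun i => lam i t w).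
  by rewrite finset.inE => /andP[].
- move=> t w; congr (sel (argmax_states C _)); apply/funext => i.
  exact: lam_stationary.
move=> _ [M _ <-]; rewrite setTI.
pose G : set (set (R * Omega)) := [set D | exists a b A,
  [/\ (a < b)%R, joint_history Phi a A & D = `]a, b]%classic `*` A]].
(* The measurable structure on pairs is here the predictable sigma-algebra of the joint history,
   which contains those of the individual histories. *)
apply: (@measurable_argmax_states _ _ C _ (g_sigma_algebraType G)
  (fun i z => lam i z.1 z.2) [set A | M (sel A)]) => i _ V mV.
have : predictable_sigma (natural_history (Phi i)) `<=` predictable_sigma (joint_history Phi).
  apply: smallest_sub; first exact: smallest_sigma_algebra.
  move=> _ [a [b [A [ab FA ->]]]]; apply: sub_gen_smallest.
  by exists a, b, A; split => //; exact: natural_history_joint FA.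
by apply; apply: (lam_predictable i); exists V.
Qed.

(** * Hit probabilities *)

(** The differences of [D] and [E], either way, contain no point of mass at least 1, so
    [diffuse_integer_measure0] makes them null. *)
Lemma integer_measure_eq (R : realType)
    (mu : {measure set (measurableTypeR R) -> \bar R}) (a b : R) (D E : set R) :
  (forall B : set R, measurable B -> bounded_set B ->
    exists n : nat, mu B = n%:R%:E) ->
  measurable D -> measurable E -> D `<=` `]a, b]%classic -> E `<=` `]a, b]%classic ->
  (forall x, 1 <= mu [set x] -> D x <-> E x) -> mu D = mu E.
Proof.
move=> muN mD mE Dab Eab DE.
have mu0 (A B : set R) : measurable A -> measurable B -> A `<=` `]a, b]%classic ->
    (forall x, 1 <= mu [set x] -> A x -> B x) -> mu (A `\` B) = 0.
  move=> mA mB Aab AB; apply: (diffuse_integer_measure0 muN (a := a) (b := b)).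
  - exact: measurableD.
  - by move=> x [/Aab].
  - by move=> x [Ax Bx]; rewrite ltNge; apply/negP => /AB/(_ Ax).
rewrite (measureDI mu mD mE) (measureDI mu mE mD).
rewrite [X in X + _]mu0//; last by move=> x /DE[].
by rewrite [X in _ = X + _]mu0// 1?setIC// => x /DE[].
Qed.

Lemma itvoc_grid (R : realType) (h x : R) n : (0 < x <= n%:R * h)%R ->
  exists2 k, (k < n)%N & `](k%:R * h)%R, (k%:R * h + h)%R]%classic x.
Proof.
elim: n => [|n IH] /andP[x0 xn]; first by move: xn; rewrite mul0r leNgt x0.
have [xnh|nhx] := leP x (n%:R * h)%R.
  by have [|k kn kx] := IH; [rewrite x0|exists k => //; rewrite ltnS ltnW].
exists n => //=; rewrite in_itv/= nhx/=; move: xn.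
by rewrite -natr1 mulrDl mul1r.
Qed.

Section common_points.
Context {d} {Omega : measurableType d} {R : realType} {N : nat}.
Variables (P : probability Omega R) (theta : R -> Omega -> Omega).
Hypothesis flow_theta : measurable_flow P theta.
Variable Phi : 'I_N -> R.-ker Omega ~> measurableTypeR R.
Hypotheses
  (stat_Phi : forall i, stationary_point_process theta (Phi i))
  (indep_Phi : independent P (fun i => sigma_point_process (Phi i)))
  (intensity_Phi : forall i, intensity P (Phi i) < +oo).

Let mPhi i s t : measurable_fun setT (fun w => Phi i w `]s, t]%classic).
Proof. by apply: measurable_kernel; exact: measurable_itv. Qed.

Let hit i s t : set Omega := [set w | 1 <= Phi i w `]s, t]%classic].

Let sigma_hit i s t : sigma_point_process (Phi i) (hit i s t).
Proof.
apply: sub_gen_smallest; exists `]s, t]%classic; first exact: measurable_itv.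
exists `[1, +oo[%classic; first exact: emeasurable_itv.
by rewrite setTI; apply/seteqP; split => w /=; rewrite /hit/= in_itv/= andbT.
Qed.

Let measurable_hit i s t : measurable (hit i s t).
Proof. exact: sigma_point_process_measurable (@sigma_hit i s t). Qed.

(** Markov's inequality at level 1. *)
Let le_hit i s t : P (hit i s t) <= \int[P]_w Phi i w `]s, t]%classic.
Proof.
rewrite -[hit i s t]setIT -integral_indic//; apply: ge0_le_integral => //.
- exact/measurable_EFinP.
- move=> w _; rewrite indicE; case: (boolP (_ \in _)) => [/set_mem hw|_].
    exact: hw.
  exact: measure_ge0.
Qed.

Let hitI i j s t : i != j -> P (hit i s t `&` hit j s t) = P (hit i s t) * P (hit j s t).
Proof.
(* Among the items other than [i], only [j] carries a condition. *)
move=> ij; pose B l := if l == j then hit l s t else setT.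
have := @independent_others _ _ _ _ _ _ indep_Phi i (hit i s t) B.
have -> : \bigcap_(l in [set l | l != i]) B l = hit j s t.
  apply/seteqP; split => [w /(_ j)|w jw l _]; rewrite /B.
    by rewrite eqxx; apply; rewrite /= eq_sym.
  by case: eqP => // ->.
apply=> // l; rewrite /B; case: eqP => // _.
by apply: sigma_algebra_setT; exact: smallest_sigma_algebra.
Qed.

(** A common point in []0, 1]] lies, for every [n], in a cell of mesh [1 / (n + 1)] hit by both
    processes. By independence and Markov's inequality each such cell has probability of order
    [1 / (n + 1)^2], so the union [B n] of the [n + 1] events has probability tending to 0. *)
Lemma no_common_points i j : i != j -> \forall w \ae P, forall x,
  (0 < x <= 1)%R -> 1 <= Phi i w [set x] -> 1 <= Phi j w [set x] -> False.
Proof.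
move=> ij.
pose h n : R := (n.+1%:R^-1)%R.
pose F n k := hit i (k%:R * h n)%R (k%:R * h n + h n)%R `&`
  hit j (k%:R * h n)%R (k%:R * h n + h n)%R.
pose B n := \big[setU/set0]_(k < n.+1) F n k.
have mB n : measurable (B n) by apply: bigsetU_measurable => k _; exact: measurableI.
have lamE l : intensity P (Phi l) = (fine (intensity P (Phi l)))%:E.
  by rewrite fineK// ge0_fin_numE// integral_ge0.
(* The interval []0, 1]] consists of [n + 1] cells of width [h n]. *)
have meanE l n : \int[P]_w Phi l w `]0%R, h n]%classic = (h n * fine (intensity P (Phi l)))%:E.
  have := mean_itv_mul flow_theta (stat_Phi l) n.+1 (h := h n).
  rewrite divff// -/(intensity P (Phi l)) lamE EFinM => ->; last by rewrite invr_ge0.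
  by rewrite muleA -EFinM mulVf// mul1e.
have PB n : P (B n) <= (h n * (fine (intensity P (Phi i)) * fine (intensity P (Phi j))))%:E.
  apply: (@le_trans _ _ (\sum_(k < n.+1) P (F n k))).
    by apply: Boole_inequality => k _; exact: measurableI.
  apply: (@le_trans _ _ (\sum_(k < n.+1) ((h n * fine (intensity P (Phi i))) *
      (h n * fine (intensity P (Phi j))))%:E)).
    apply: lee_sum => k _; rewrite /F hitI// EFinM -!meanE.
    apply: lee_pmul => //.
      by rewrite -(mean_itv_shift flow_theta (stat_Phi i) (k%:R * h n)%R) le_hit.
    by rewrite -(mean_itv_shift flow_theta (stat_Phi j) (k%:R * h n)%R) le_hit.
  rewrite sumEFin lee_fin sumr_const card_ord -mulr_natl !mulrA.
  by rewrite mulfV// mul1r -!mulrA mulrCA.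
exists (\bigcap_n B n); split.
- exact: bigcapT_measurable.
- apply/eqP; rewrite eq_le measure_ge0 andbT; apply/lee_addgt0Pr => e e0.
  rewrite add0e; pose c := (fine (intensity P (Phi i)) * fine (intensity P (Phi j)))%R.
  have c0 : (0 <= c)%R by rewrite mulr_ge0// fine_ge0// integral_ge0.
  (* [c] may vanish, so [c + 1] serves as the divisor below. *)
  have c1 : (0 < c + 1)%R by rewrite ltr_wpDl.
  have [n] := ltr_add_invr (divr_gt0 e0 c1); rewrite add0r => hn.
  apply: (@le_trans _ _ (P (B n))).
    apply: le_measure; rewrite ?inE//; first exact: bigcapT_measurable.
    exact: bigcap_inf.
  rewrite (le_trans (PB n))// lee_fin -/c.
  apply: (@le_trans _ _ (e / (c + 1) * c)%R); first by rewrite ler_wpM2r// ltW.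
  by rewrite mulrAC ler_pdivrMr// ler_pM2l// lerDl.
- move=> w /= /existsNP[x]; rewrite !not_implyE => -[x01 [ix [jx _]]] n _.
  have [|k kn kx] := @itvoc_grid _ (h n) x n.+1; first by rewrite divff.
  rewrite /B -(bigcup_mkord _ (F n)); exists k => //=; split; rewrite /hit/=.
    apply: (le_trans ix); apply: le_measure; rewrite ?inE//.
    by move=> _ ->.
  apply: (le_trans jx); apply: le_measure; rewrite ?inE//.
  by move=> _ ->.
Qed.

End common_points.

Section hit_probability.
Context {d} {Omega : measurableType d} {R : realType} {N : nat}.
Variables (P : probability Omega R) (theta : R -> Omega -> Omega).
Hypothesis flow_theta : measurable_flow P theta.
Variable Phi : 'I_N -> R.-ker Omega ~> measurableTypeR R.
Hypotheses (pp_Phi : forall i, point_process (Phi i))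
  (simple_Phi : forall i, simple_process P (Phi i))
  (stat_Phi : forall i, stationary_point_process theta (Phi i))
  (indep_Phi : independent P (fun i => sigma_point_process (Phi i)))
  (intensity_Phi : forall i, intensity P (Phi i) < +oo).
Variables (C : nat) (pol : R -> Omega -> {set 'I_N}).
Hypothesis causal_pol : causal_policy C theta (joint_history Phi) pol.

Let D i : set (R * Omega) := [set z | i \in pol z.1 z.2].

Let mD i : measurable (D i).
Proof.
have [_ Fm _] := joint_history_filtration Phi.
apply: (predictable_sigma_measurable Fm).
exact: measurable_policy causal_pol.
Qed.

(** Moving the origin to [s] turns hits at 0 into hits at [s], because the policy and the processes
    shift together by stationarity. *)
Lemma hit_process_flow s w :
  hit_process Phi pol (theta s w) [set 0%R] =
  \sum_(i < N) Phi i w [set s] * (i \in pol s w)%:R%:E.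
Proof.
have m0 : measurable ([set 0%R] : set R) by exact: measurable_set1.
apply: eq_bigr => i _; rewrite (integral_policy _ _ causal_pol)//.
have [_ spol _] := causal_pol.
rewrite stat_Phi; last first.
  by apply: measurableI => //; exact: (measurable_ysection _ (@mD i)).
have [ipol|ipol] := boolP (i \in pol s w).
  rewrite mule1; congr (Phi i w _); apply/seteqP; split => x /=.
    by move=> [y [-> _] <-]; rewrite add0r.
  move=> ->; exists 0%R; last by rewrite add0r.
  by split => //; rewrite /ysection/= inE/= -spol.
rewrite mule0 (_ : [set _ | x in _] = set0) ?measure0//.
apply/seteqP; split => // x [y [-> +] _].
by rewrite /ysection/= inE/= -spol (negbTE ipol).
Qed.

Let hits : set Omega := [set w | hit_process Phi pol w [set 0%R] = 1].

Let measurable_hits : measurable hits.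
Proof.
have [_ flow0 _ _] := flow_theta.
have mhit : measurable_fun setT (fun w => hit_process Phi pol w [set 0%R]).
  rewrite (_ : (fun _ => _) = fun w =>
      \sum_(i < N) Phi i w [set 0%R] * (\1_(xsection (D i) 0%R) w)%:E).
    apply: emeasurable_sum => i; apply: emeasurable_funM.
      by apply: measurable_kernel; exact: measurable_set1.
    apply/measurable_EFinP; apply: measurable_indic.
    exact: (measurable_xsection _ (@mD i)).
  (* At time 0 the flow is the identity, so [hit_process_flow] applies to [w] itself. *)
  apply/funext => w; rewrite -{1}(flow0 w) hit_process_flow.
  apply: eq_bigr => i _; rewrite indicE mem_xsection.
  congr (_ * _%:R%:E); congr nat_of_bool.
  by apply/idP/idP => [?|/set_mem//]; exact/mem_set.
by have := mhit measurableT [set 1] (emeasurable_set1 1); rewrite setTI.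
Qed.

(** The Palm integral counts the points of [Phi i] at times seen from which the origin carries
    exactly one hit; the hit rate counts those at which [i] is stored. Almost surely points are
    simple and unshared, so the two sets of times contain the same atoms of [Phi i] in []0, 1]], and
    [integer_measure_eq] applies. *)
Lemma hit_probabilityE :
  hit_probability P theta Phi pol =
  (intensity P (superposition Phi))^-1 * hit_rate P Phi pol.
Proof.
rewrite /hit_probability /palm; congr (_ * _).
have [mtheta _ _ _] := flow_theta.
pose E : set (R * Omega) := (fun x => theta x.1 x.2) @^-1` hits.
have mE : measurable E by rewrite -[E]setTI; exact: mtheta.
have m01 : measurable (`]0%R, 1%R]%classic : set R) by exact: measurable_itv.
have palmE w : \int[superposition Phi w]_(s in `]0%R, 1%R]) (\1_hits (theta s w))%:E =
    \sum_(i < N) Phi i w (`]0%R, 1%R]%classic `&` ysection E w).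
  rewrite -[RHS]/(superposition Phi w _) setIC -integral_indic//; last first.
    exact: measurable_ysection.
  by apply: eq_integral => s _; rewrite !indicE mem_ysection.
under eq_integral => w _ do rewrite palmE.
have rateE w : hit_process Phi pol w `]0%R, 1%R] =
    \sum_(i < N) Phi i w (`]0%R, 1%R]%classic `&` ysection (D i) w).
  by apply: eq_bigr => i _; rewrite (integral_policy _ _ causal_pol).
rewrite /hit_rate; under [RHS]eq_integral => w _ do rewrite rateE.
apply: ae_eq_integral => //.
- by apply: emeasurable_sum => i; exact: measurable_kernel_ysection.
- apply: emeasurable_sum => i.
  exact: (measurable_kernel_ysection _ _ (@pp_Phi i) (@mD i)).
have simple_ae : \forall w \ae P, forall i x, Phi i w [set x] <= 1.
  exact: filter_forall simple_Phi.
have distinct_ae : \forall w \ae P, forall i j, i != j -> forall x,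
    (0 < x <= 1)%R -> 1 <= Phi i w [set x] -> 1 <= Phi j w [set x] -> False.
  apply: filter_forall => i; apply: filter_forall => j.
  have [->|ij] := eqVneq i j; first exact: aeW.
  by apply: filterS (no_common_points flow_theta stat_Phi indep_Phi intensity_Phi ij) => w.
apply: filterS2 simple_ae distinct_ae => w simple_w distinct_w _.
apply: eq_bigr => i _.
apply: (integer_measure_eq (pp_Phi i w) (a := 0%R) (b := 1%R)).
- by apply: measurableI => //; exact: measurable_ysection.
- by apply: measurableI => //; exact: (measurable_ysection _ (@mD i)).
- exact: subIsetl.
- exact: subIsetl.
move=> s is1.
have isE : Phi i w [set s] = 1 by apply/eqP; rewrite eq_le simple_w is1.
have hitE : (0 < s <= 1)%R -> hit_process Phi pol (theta s w) [set 0%R] = (i \in pol s w)%:R%:E.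
  move=> s01; rewrite hit_process_flow (bigD1 i)//= isE mul1e big1 ?adde0// => j ji.
  (* The mass of [Phi j] at [s] is a natural number; a nonzero one would make [s] a common point of
     [i] and [j]. So only the term of [i] survives. *)
  have [|n jsE] := pp_Phi j w (measurable_set1 s).
    apply: (@sub_itvoc_bounded _ (s - 1) s) => _ ->/=.
    by rewrite in_itv/= lexx andbT ltrBlDr ltrDl.
  move: (distinct_w _ _ ji s s01); rewrite jsE lee_fin (ler_nat _ 1 n).
  by case: n {jsE} => [|n] //=; [rewrite mul0e|move=> /(_ isT)/(_ is1)].
split => -[s01]; rewrite /ysection/= inE/= => hs; split => //; rewrite inE /E/hits/D/=.
  move: hs; rewrite /E/hits/= hitE; last exact: s01.
  case: (i \in pol s w) => [_|]; first exact: isT.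
  by move/eqP; rewrite eqe eq_sym oner_eq0.
rewrite hitE; last exact: s01.
by rewrite hs.
Qed.

End hit_probability.

(** * Comparison of causal policies *)

Theorem theorem1 (R : realType) (d : measure_display) (Omega : measurableType d)
    (P : probability Omega R) (theta : R -> Omega -> Omega)
    (flow_theta : measurable_flow P theta)
    (N C : nat) (ltCN : (C < N)%N)
    (Phi : 'I_N -> R.-ker Omega ~> measurableTypeR R)
    (pp_Phi : forall i, point_process (Phi i))
    (simple_Phi : forall i, simple_process P (Phi i))
    (stat_Phi : forall i, stationary_point_process theta (Phi i))
    (indep_Phi : independent P (fun i => sigma_point_process (Phi i)))
    (intensity_Phi : forall i, 0 < intensity P (Phi i) < +oo)
    (lam : 'I_N -> R -> Omega -> R)
    (lam_intensity : forall i,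
      stochastic_intensity P (natural_history (Phi i)) (Phi i) (lam i))
    (lam_predictable : forall i,
      predictable (natural_history (Phi i)) measurable (lam i))
    (lam_stationary : forall i, stationary_process theta (lam i))
    (sel : {set {set 'I_N}} -> {set 'I_N}) (sel_ties : tie_breaking sel) :
  let F := joint_history Phi in
  let Cstar := optimal_policy C sel lam in
  causal_policy C theta F Cstar /\
  forall pol : R -> Omega -> {set 'I_N}, causal_policy C theta F pol ->
    [/\ hit_rate P Phi pol = 'E_P[policy_intensity lam pol 0%R],
        'E_P[policy_intensity lam pol 0%R] <=
          'E_P[policy_intensity lam Cstar 0%R],
        'E_P[policy_intensity lam Cstar 0%R] = hit_rate P Phi Cstar &
        hit_probability P theta Phi pol <= hit_probability P theta Phi Cstar].
Proof.
move=> F Cstar.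
have fin_Phi i : intensity P (Phi i) < +oo by have /andP[] := intensity_Phi i.
have causal_star : causal_policy C theta F Cstar by exact: optimal_policy_causal.
split=> [|pol causal_pol]; first exact: causal_star.
have rateE (p : R -> Omega -> {set 'I_N}) : causal_policy C theta F p ->
    hit_rate P Phi p = 'E_P[policy_intensity lam p 0%R].
  exact: (hit_rate_policy_intensity flow_theta pp_Phi indep_Phi fin_Phi
    lam_intensity lam_predictable lam_stationary).
have mlam p : causal_policy C theta F p ->
    measurable_fun setT (fun w => (policy_intensity lam p 0%R w)%:E).
  exact: (measurable_policy_intensity lam_predictable).
have lam0 i t w : (0 <= lam i t w)%R by have [] := lam_intensity i.
have int_ge0 p w : 0 <= (policy_intensity lam p 0%R w)%:E.
  by rewrite lee_fin sumr_ge0// => i _; rewrite mulr_ge0.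
have leE : 'E_P[policy_intensity lam pol 0%R] <= 'E_P[policy_intensity lam Cstar 0%R].
  rewrite expectation.unlock; apply: ge0_le_integral => //; try exact: mlam.
  move=> w _; rewrite lee_fin; apply: optimal_policy_max => //.
  by have [polC _ _] := causal_pol; exact: polC.
split; [exact: rateE|exact: leE|by rewrite rateE|].
(* Both hit probabilities are hit rates scaled by the same nonnegative factor, so the order of the
   hit rates carries over. *)
rewrite (hit_probabilityE flow_theta pp_Phi simple_Phi stat_Phi indep_Phi fin_Phi causal_pol).
rewrite (hit_probabilityE flow_theta pp_Phi simple_Phi stat_Phi indep_Phi fin_Phi causal_star).
apply: lee_wpmul2l; last by rewrite !rateE.
by rewrite inve_ge0 integral_ge0.
Qed.
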